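(* For every positive integer $n$, the sequence of coefficients $I^B_{n,0},I^B_{n,1},\dots,I^B_{n,n}$ of $I_n^B(x)=\sum_{w\in I_n^B}x^{\mathrm{des}_B(w)}=\sum_{k=0}^n I^B_{n,k}x^k$ is unimodal, i.e. there is an index $j$ with $I^B_{n,0}\le\cdots\le I^B_{n,j}\ge I^B_{n,j+1}\ge\cdots\ge I^B_{n,n}$.
   Context: $B_n$ is the group of signed permutations, i.e. bijections $w$ of $\{\pm1,\dots,\pm n\}$ with $w(-a)=-w(a)$, and $I_n^B=\{w\in B_n: w^{-1}=w\}$. Use the total order $-1<_r-2<_r\cdots<_r 0<_r 1<_r 2<_r\cdots$ on $\mathbb{Z}$. For $w\in B_n$ set $w(0):=0$ and define $\mathrm{des}_B(w)=|\{i\in\{0,1,\dots,n-1\} : w(i)>_r w(i+1)\}|$. *)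

(* Defs.v *)
From mathcomp Require Import all_boot all_order all_algebra all_fingroup.

Set Implicit Arguments.
Unset Strict Implicit.
Unset Printing Implicit Defensive.

Import Order.TTheory GRing.Theory Num.Theory.
Local Open Scope ring_scope.

(* The set {±1, ..., ±n}: the pair (s, i) stands for (-1)^s (i + 1). *)
Notation letter n := (bool * 'I_n)%type.

Definition letter_val n (a : letter n) : int := (-1) ^+ a.1 * (a.2.+1)%:Z.

Definition letter_opp n (a : letter n) : letter n := (~~ a.1, a.2).

Lemma letter_val_opp n (a : letter n) :
  letter_val (letter_opp a) = - letter_val a.
Proof. by rewrite /letter_val; case: a => [[] i] /=; rewrite ?expr1 ?expr0 !mulN1r ?mul1r ?opprK. Qed.

Lemma letter_val_inj n : injective (@letter_val n).
Proof.
move=> [s i] [t j]; rewrite /letter_val /= => e.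
have eij : i = j.
  apply/val_inj/succn_inj; move/(congr1 absz): e.
  by rewrite !abszM !abszX !exp1n !mul1n.
by subst j; case: s t e => [] [].
Qed.

Definition signed_perms n : {set {perm letter n}} :=
  [set w : {perm letter n} |
    [forall a : letter n, w (letter_opp a) == letter_opp (w a)]].

Definition signed_involutions n : {set {perm letter n}} :=
  [set w in signed_perms n | (w^-1)%g == w].

(* w as a map on all integers; integers outside {±1, ..., ±n}, in particular
   0, are fixed. *)
Definition sperm_fun n (w : {perm letter n}) (z : int) : int :=
  if [pick a : letter n | letter_val a == z] is Some a
  then letter_val (w a) else z.

Lemma sperm_fun_letter n (w : {perm letter n}) (a : letter n) :
  sperm_fun w (letter_val a) = letter_val (w a).
Proof.
rewrite /sperm_fun; case: pickP => [b /eqP/letter_val_inj -> //|/(_ a)].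
by rewrite eqxx.
Qed.

Lemma sperm_fun0 n (w : {perm letter n}) : sperm_fun w 0 = 0.
Proof.
rewrite /sperm_fun; case: pickP => // a; rewrite /letter_val.
by rewrite mulf_eq0 signr_eq0.
Qed.

(* The strict total order -1 <_r -2 <_r ... <_r 0 <_r 1 <_r 2 <_r ... *)
Definition ltr_r (x y : int) : bool :=
  if x < 0 then (0 <= y) || (y < x) else x < y.

Definition desB n (w : {perm letter n}) : nat :=
  #|[set i : 'I_n | ltr_r (sperm_fun w i.+1%:Z) (sperm_fun w i%:Z)]|.

Definition IB_poly n : {poly int} :=
  \sum_(w in signed_involutions n) 'X^(desB w).

Definition unimodal (c : nat -> int) (n : nat) : Prop :=
  exists j : nat,
    [/\ (j <= n)%N,
        forall k : nat, (k < j)%N -> c k <= c k.+1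
      & forall k : nat, (j <= k)%N -> (k < n)%N -> c k.+1 <= c k].

(* Main.v *)
(** A signed involution [w] together with a weakly increasing word
    [0 <= a_1 <= ... <= a_n <= m] that increases strictly at the descents of [w]
    (with [a_0 = 0]) is the same thing as a multiset of [n] columns
    [(a_i, sign (w i), a_|w i|)] that is invariant under exchanging the two
    entries: sort the columns and let [w] pair the r-th copy of a column with
    the r-th copy of its exchange.  For fixed [w] there are
    ['C(m + n - desB w, n)] such words, so, [f n m] being the number of symmetric
    multisets,
      [\sum_k I_(n,k) 'C(m + n - k, n) = f n m].
    Summing the multiplicity of every column over all symmetric multisets gives
      [n f n m = (2m + 1) f (n - 1) m + (2m^2 + 2m + n - 1) f (n - 2) m],
    which translates into a recurrence for the [I_(n,k)] with nonnegative
    coefficients.  By induction that recurrence forces [I_(n,k) = I_(n,n-k)] and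
    [I_(n,k-1) <= I_(n,k)] for [2k <= n]. *)

Require Import Defs.
From mathcomp Require Import all_boot all_order all_algebra all_fingroup.
From mathcomp Require Import zify ring.

Set Implicit Arguments.
Unset Strict Implicit.
Unset Printing Implicit Defensive.

Import Order.TTheory GRing.Theory Num.Theory.

(** * Increasing words with prescribed strict ascents *)

(** The lexicographic order on pairs with [r] breaking ties: equal numbers may follow each other
    only along [r]. *)
Definition lift_lt (U : Type) (r : rel U) : rel (nat * U) :=
  fun p q => p.1 + ~~ r p.2 q.2 <= q.1.

Lemma sum_hockey_stick (M d n : nat) : d <= n ->
  \sum_(z < M) 'C(z + n - d, n) = 'C(M + n - d, n.+1).
Proof.
move=> dn; elim: M => [|M IH]; first by rewrite big_ord0 bin_small // ltnS leq_subr.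
rewrite big_ord_recr /= IH (_ : M.+1 + n - d = (M + n - d).+1) ?binS //; lia.
Qed.

(** Split off the first number [y]: by induction it has ['C(m - y + n - d, n)] continuations, and
    summing over the admissible [y] gives a hockey-stick sum. *)
Lemma card_lift_lt (U : Type) (r : rel U) (m n x : nat) (u : U) (us : seq U) :
  size us = n -> x <= m ->
  #|[set t : n.-tuple 'I_m.+1 |
       path (lift_lt r) (x, u) (zip (map val t) us)]| =
  'C(m - x + n - count id (pairmap (fun v v' => ~~ r v v') u us), n).
Proof.
elim: n x u us => [|n IH] x u [|v us] //=.
  move=> _ _; rewrite bin0 -[RHS](card_tuple 0 'I_m.+1); apply: eq_card => t.
  by rewrite !inE tuple0.
case=> us_n xm; set d := count id _.
have dn : d <= n.
  by rewrite -us_n -(size_pairmap (fun v v' => ~~ r v v') v us) count_size.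
rewrite -sum1_card.
rewrite (reindex (fun p : 'I_m.+1 * n.-tuple 'I_m.+1 => cons_tuple p.1 p.2)) /=;
  last first.
  exists (fun t => (thead t, behead_tuple t)) => [[y t] _|t _] /=.
    by congr (_, _); apply: val_inj.
  by apply: val_inj; rewrite /= [t]tuple_eta.
rewrite (eq_bigl (fun p : 'I_m.+1 * n.-tuple 'I_m.+1 => (x + ~~ r u v <= p.1) &&
   (p.2 \in [set t : n.-tuple 'I_m.+1 |
       path (lift_lt r) (nat_of_ord p.1, v) (zip (map val t) us)]))); last first.
  by move=> [y t]; rewrite !inE.
rewrite -(pair_big_dep (fun y : 'I_m.+1 => x + ~~ r u v <= y)
  (fun y t => t \in [set t : n.-tuple 'I_m.+1 |
       path (lift_lt r) (nat_of_ord y, v) (zip (map val t) us)]) (fun _ _ => 1)) /=.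
under eq_bigr => y _ do rewrite sum1_card IH ?leq_ord // -/d.
set c := ~~ r u v.
have -> : m - x + n.+1 - (c + d) = (m.+1 - (x + c)) + n - d by case: (c); lia.
rewrite -sum_hockey_stick //.
(* The substitution [z = m - y] turns the range [x + c <= y <= m] into [z < m.+1 - (x + c)]. *)
rewrite (big_ord_widen m.+1 (fun z => 'C(z + n - d, n))) ?leq_subr //.
rewrite (reindex_inj rev_ord_inj) /=; apply: eq_big => y; last first.
  by rewrite subSS subKn // -ltnS.
by have := ltn_ord y; lia.
Qed.

(** * Multisets invariant under an involution *)

Section SymmetricMultisets.
Variables (T : finType) (s : T -> T) (L : {set T}).
Hypotheses (sK : involutive s) (sL : forall c, (s c \in L) = (c \in L)).

(* The bound [N] on multiplicities only makes the type finite: for [n <= N] it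
   does not restrict multisets of size [n]. *)
Definition symm_mset N n : {set {ffun T -> 'I_N.+1}} :=
  [set A : {ffun T -> 'I_N.+1} |
    [&& \sum_c A c == n, [forall c, A (s c) == A c]
      & [forall c, (c \notin L) ==> (A c == ord0)]]].

Lemma symm_msetP N n (A : {ffun T -> 'I_N.+1}) :
  reflect [/\ \sum_c A c = n, forall c, A (s c) = A c
            & forall c, c \notin L -> A c = 0 :> nat] (A \in symm_mset N n).
Proof.
rewrite inE; apply: (iffP and3P) => -[h1 h2 h3]; split.
- exact/eqP.
- by move=> c; have /eqP := forallP h2 c.
- by move=> c cL; have := forallP h3 c; rewrite cL => /eqP ->.
- exact/eqP.
- by apply/forallP => c; rewrite h2.
- by apply/forallP => c; apply/implyP => /h3 h; apply/eqP/val_inj.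
Qed.

Lemma symm_mset_le N n A c : A \in symm_mset N n -> A c <= n.
Proof. by case/symm_msetP => <- _ _; rewrite (bigD1 c) //= leq_addr. Qed.

Lemma symm_mset_val_inj N (A A' : {ffun T -> 'I_N.+1}) :
  (forall c, A c = A' c :> nat) -> A = A'.
Proof. by move=> h; apply/ffunP => c; apply/val_inj/h. Qed.

(** Indicator and size of the orbit of [c] under [s]. Whole orbits are the units that can be added
    to or removed from a symmetric multiset. *)
Let orb c x : nat := (x == c) || (x == s c).
Let olen c : nat := if s c == c then 1 else 2.

Let orb_s c x : orb c (s x) = orb c x.
Proof.
by rewrite /orb (can_eq sK) -(can_eq sK (s x)) sK orbC.
Qed.

Let sum_orb c : \sum_x orb c x = olen c.
Proof.
transitivity #|[set c; s c]|; last by rewrite cards2 eq_sym /olen; case: eqP.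
rewrite -sum1_card [RHS]big_mkcond; apply: eq_bigr => x _.
by rewrite !inE /orb; case: (_ || _).
Qed.

Let add_orb N c (A : {ffun T -> 'I_N.+1}) : {ffun T -> 'I_N.+1} :=
  [ffun x => inord (A x + orb c x)].
Let sub_orb N c (A : {ffun T -> 'I_N.+1}) : {ffun T -> 'I_N.+1} :=
  [ffun x => inord (A x - orb c x)].

Let sub_orbE N c (A : {ffun T -> 'I_N.+1}) x :
  sub_orb c A x = A x - orb c x :> nat.
Proof. by rewrite ffunE inordK //; have := ltn_ord (A x); lia. Qed.

Let add_orbE N n c (A : {ffun T -> 'I_N.+1}) x : n < N -> A \in symm_mset N n ->
  add_orb c A x = A x + orb c x :> nat.
Proof.
move=> nN An; rewrite ffunE inordK //; have := symm_mset_le x An.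
move=> le1; rewrite ltnS; apply: leq_trans nN; rewrite -(addn1 n) leq_add //.
exact: leq_b1.
Qed.

Let orb_le N n c (A : {ffun T -> 'I_N.+1}) x : A \in symm_mset N n -> 0 < A c ->
  orb c x <= A x.
Proof.
case/symm_msetP => _ h _ Ac; rewrite /orb.
by case: eqP => [-> //|_]; case: eqP => [->|//]; rewrite h.
Qed.

Let sub_orb_in N n c (A : {ffun T -> 'I_N.+1}) :
  A \in symm_mset N (n + olen c) -> 0 < A c -> sub_orb c A \in symm_mset N n.
Proof.
move=> An Ac; have le x := orb_le x An Ac.
have [h1 h2 h3] := symm_msetP _ _ An.
apply/symm_msetP; split.
- under eq_bigr => x _ do rewrite sub_orbE.
  by rewrite sumnB ?h1 ?sum_orb ?addnK.
- by move=> x; apply: val_inj => /=; rewrite !sub_orbE h2 orb_s.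
- by move=> x xL; rewrite sub_orbE h3.
Qed.

Let sub_orbK N n c (A : {ffun T -> 'I_N.+1}) :
  A \in symm_mset N n -> 0 < A c -> add_orb c (sub_orb c A) = A.
Proof.
move=> An Ac; apply: symm_mset_val_inj => x.
rewrite ffunE sub_orbE subnK ?(orb_le x An Ac) // inordK //.
Qed.

Let add_orb_in N n c (A : {ffun T -> 'I_N.+1}) :
  c \in L -> n < N -> A \in symm_mset N n ->
  add_orb c A \in symm_mset N (n + olen c).
Proof.
move=> cL nN An; have [h1 h2 h3] := symm_msetP _ _ An.
apply/symm_msetP; split.
- under eq_bigr => x _ do rewrite (add_orbE _ _ nN An).
  by rewrite big_split /= h1 sum_orb.
- by move=> x; apply: val_inj => /=; rewrite !(add_orbE _ _ nN An) h2 orb_s.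
- move=> x xL; rewrite (add_orbE _ _ nN An) h3 // /orb.
  case: eqP => [e|_]; first by rewrite -e (negPf xL) in cL.
  case: eqP => [e|//]; by rewrite -sL -e (negPf xL) in cL.
Qed.

Let add_orbK N n c (A : {ffun T -> 'I_N.+1}) :
  n < N -> A \in symm_mset N n -> sub_orb c (add_orb c A) = A.
Proof.
move=> nN An; apply: symm_mset_val_inj => x.
by rewrite sub_orbE (add_orbE _ _ nN An) addnK.
Qed.

Let weight N n c := \sum_(A in symm_mset N n) A c.

(* Remove the orbit of [c] from the multisets that contain it. *)
Let weight_step N n c : c \in L -> n < N ->
  weight N (n + olen c) c = weight N n c + #|symm_mset N n|.
Proof.
move=> cL nN; rewrite /weight (bigID (fun A : {ffun T -> 'I_N.+1} => 0 < A c)) /=.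
rewrite [X in _ + X]big1 ?addn0; last by move=> A /andP[_]; rewrite -eqn0Ngt => /eqP.
rewrite (reindex_onto (@add_orb N c) (@sub_orb N c)); last first.
  by move=> A /andP[An Ac]; apply: sub_orbK An Ac.
rewrite -sum1_card -big_split /=; apply: eq_big => A.
  apply/idP/idP => [/andP[/andP[h1 h2] /eqP <-]|An].
    exact: sub_orb_in.
  rewrite add_orb_in // (add_orbK _ nN An) (add_orbE _ _ nN An) /orb eqxx addn1 /=.
  exact: eqxx.
move=> /andP[/andP[h1 h2] /eqP e].
have An : A \in symm_mset N n by rewrite -e; apply: sub_orb_in.
by rewrite (add_orbE _ _ nN An) /orb eqxx.
Qed.

(** Double counting: every multiset of size [n] has total multiplicity [n], all of it on [L]. *)
Let sum_weight N n : n * #|symm_mset N n| = \sum_(c in L) weight N n c.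
Proof.
rewrite /weight exchange_big /= mulnC -sum_nat_const; apply: eq_bigr => A.
case/symm_msetP => h1 _ h3; rewrite -[LHS]h1 (bigID (fun c => c \in L)) /=.
by rewrite [X in _ + X]big1 ?addn0.
Qed.

(** Reduce the weight of each [c] in [L] from size [n + 2] to size [n]: one orbit removal if [s]
    moves [c], two if [s] fixes it, the extra one contributing [#|symm_mset N n.+1|]. The remaining
    weights add up to [n * #|symm_mset N n|] by double counting. *)
Lemma card_symm_mset_rec N n : n.+2 <= N ->
  n.+2 * #|symm_mset N n.+2| =
  #|[set c in L | s c == c]| * #|symm_mset N n.+1| + (#|L| + n) * #|symm_mset N n|.
Proof.
move=> nN; rewrite sum_weight.
rewrite (eq_bigr (fun c => weight N n c + #|symm_mset N n| +
           (s c == c) * #|symm_mset N n.+1|)); last first.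
  move=> c cL; have [e|ne] := eqVneq (s c) c.
    have o1 : olen c = 1 by rewrite /olen e eqxx.
    have := weight_step cL (ltnW nN); rewrite o1 addn1 => h1.
    have := weight_step cL nN; rewrite o1 addn1 => ->.
    by rewrite h1 mul1n.
  have o2 : olen c = 2 by rewrite /olen (negPf ne).
  have := weight_step cL (ltnW nN); rewrite o2 addn2 => ->.
  by rewrite mul0n addn0.
rewrite !big_split /= -sum_weight sum_nat_const -big_distrl /=.
rewrite (_ : \sum_(c in L) (s c == c) = #|[set c in L | s c == c]|); first by lia.
rewrite -sum1_card big_mkcond [RHS]big_mkcond /=; apply: eq_bigr => c _.
by rewrite inE; case: (c \in L); case: eqP.
Qed.

Lemma card_symm_mset0 N : #|symm_mset N 0| = 1.
Proof.
rewrite -(cards1 ([ffun=> ord0] : {ffun T -> 'I_N.+1})).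
apply: eq_card => A; rewrite in_set1; apply/idP/eqP => [An|->].
  apply: symm_mset_val_inj => c; rewrite ffunE.
  by have := symm_mset_le c An; rewrite leqn0 => /eqP.
apply/symm_msetP; split=> [|c|c _]; rewrite ?ffunE //.
by rewrite big1 // => c _; rewrite ffunE.
Qed.

Lemma card_symm_mset1 N : 0 < N -> #|symm_mset N 1| = #|[set c in L | s c == c]|.
Proof.
move=> N0; rewrite -[LHS]mul1n sum_weight.
rewrite -sum1_card big_mkcond [RHS]big_mkcond /=; apply: eq_bigr => c _.
rewrite inE; case cL: (c \in L) => //=; case: eqP => [e|/eqP ne].
  have o1 : olen c = 1 by rewrite /olen e eqxx.
  have := weight_step cL N0; rewrite o1 add0n => ->.
  rewrite card_symm_mset0 /weight big1 // => A An.
  by have := symm_mset_le c An; rewrite leqn0 => /eqP.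
(* Here [c] and [s c] are distinct with equal multiplicities, so a total size of one leaves none for
   [c]. *)
rewrite /weight big1 // => A /symm_msetP[h1 h2 _].
move: h1; rewrite (bigD1 c) //= (bigD1 (s c)) //= h2.
by case: (nat_of_ord (A c)) => [//|k]; lia.
Qed.

End SymmetricMultisets.

(** * Descents of signed permutations *)

(** Under this key [<_r] is lexicographic: negative integers ([false]) come first, and within each
    sign class the absolute value increases. *)
Definition int_key (z : int) : bool * nat := ((0 <= z)%R, `|z|%N).

Definition key_lt : rel (bool * nat) := fun p q =>
  (~~ p.1 && q.1) || ((p.1 == q.1) && (p.2 < q.2)).

Lemma key_lt_trans : transitive key_lt.
Proof. by move=> [[] y] [[] x] [[] z] //=; rewrite /key_lt /=; lia. Qed.

Lemma key_lt_total p q : p != q -> key_lt p q = ~~ key_lt q p.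
Proof.
by case: p q => [[] x] [[] y]; rewrite xpair_eqE /key_lt //=; lia.
Qed.

Lemma ltr_rE x y : ltr_r x y = key_lt (int_key x) (int_key y).
Proof.
rewrite /ltr_r /key_lt /int_key /= !(leNgt 0%R).
by case: (ltP x 0%R) => hx; case: (ltP y 0%R) => hy /=; lia.
Qed.

Definition sperm_keys n (w : {perm letter n}) : seq (bool * nat) :=
  [seq int_key (sperm_fun w j.+1%:Z) | j <- iota 0 n].

Definition img_neg n (w : {perm letter n}) i : bool := (w (false, i)).1.
Definition img_abs n (w : {perm letter n}) i : 'I_n := (w (false, i)).2.

Lemma size_sperm_keys n (w : {perm letter n}) : size (sperm_keys w) = n.
Proof. by rewrite size_map size_iota. Qed.

Lemma nth_sperm_keys n (w : {perm letter n}) (i : 'I_n) u :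
  nth u (sperm_keys w) i = (~~ img_neg w i, (img_abs w i).+1).
Proof.
rewrite (nth_map 0) ?size_iota // nth_iota // add0n.
rewrite (_ : Posz i.+1 = letter_val (false, i)); last by rewrite /letter_val /=; lia.
rewrite sperm_fun_letter /img_neg /img_abs; case: (w _) => [[] j] /=;
  by rewrite /int_key /letter_val /=; congr (_, _); lia.
Qed.

(** Successive keys differ, as [w] is injective and no letter has value 0, so failing to ascend
    means descending. The initial key [(true, 0)] is that of [w(0) = 0]. *)
Lemma desB_keys n (w : {perm letter n}) :
  desB w = count id (pairmap (fun u v => ~~ key_lt u v) (true, 0) (sperm_keys w)).
Proof.
rewrite /desB -sum1dep_card big_mkcond /= -sum1_count.
rewrite (big_nth false) size_pairmap size_sperm_keys big_mkord.
rewrite [RHS]big_mkcond; apply: eq_bigr => i _.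
rewrite (nth_pairmap (true, 0)) ?size_sperm_keys //.
rewrite nth_sperm_keys ltr_rE.
have -> : int_key (sperm_fun w i.+1) = (~~ img_neg w i, (img_abs w i).+1).
  rewrite -(nth_sperm_keys w i (true, 0)) (nth_map 0) ?size_iota //.
  by rewrite nth_iota // add0n.
suff [-> ne] :
   int_key (sperm_fun w i) = nth (true, 0) ((true, 0) :: sperm_keys w) i
   /\ nth (true, 0) ((true, 0) :: sperm_keys w) i !=
      (~~ img_neg w i, (img_abs w i).+1).
  by rewrite [in RHS]key_lt_total // negbK.
case: i => [[|i] lti] /=.
  by rewrite sperm_fun0; split => //; rewrite xpair_eqE andbF.
have lti' : i < n by apply: ltnW.
rewrite (nth_sperm_keys w (Ordinal lti')); split.
  rewrite -(nth_sperm_keys w (Ordinal lti') (true, 0)) (nth_map 0) ?size_iota //.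
  by rewrite nth_iota // add0n.
rewrite xpair_eqE eqSS; apply/negP => /andP[/eqP/negb_inj h1 /eqP/val_inj h2].
have : w (false, Ordinal lti') = w (false, Ordinal lti).
  by rewrite [LHS]surjective_pairing [RHS]surjective_pairing; congr (_, _).
by move/perm_inj => -[] /eqP; rewrite eqn_leq ltnn andbF.
Qed.

Definition compatible m n (w : {perm letter n}) (a : n.-tuple 'I_m.+1) : bool :=
  path (lift_lt key_lt) (0, (true, 0)) (zip (map val a) (sperm_keys w)).

Lemma card_compatible m n (w : {perm letter n}) :
  #|[set a : n.-tuple 'I_m.+1 | compatible w a]| = 'C(m + n - desB w, n).
Proof. by rewrite card_lift_lt ?size_sperm_keys // subn0 desB_keys. Qed.

Lemma lift_lt_trans (U : Type) (r : rel U) :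
  transitive r -> transitive (lift_lt r).
Proof.
move=> tr [y v] [x u] [z t]; rewrite /lift_lt /=; have := tr v u t.
by case: (r u v) (r v t) (r u t) => [] [] [] //= h; try lia; have := h isT isT.
Qed.

(** Transitivity of [lift_lt] replaces neighbours by arbitrary pairs of positions. Comparison with
    the initial pair [(0, (true, 0))] only forbids the value 0 where [w] is negative. *)
Lemma compatibleP m n (w : {perm letter n}) (a : n.-tuple 'I_m.+1) :
  reflect
    ((forall i, img_neg w i -> 0 < tnth a i) /\
     (forall i j : 'I_n, i < j -> tnth a i +
        ~~ key_lt (~~ img_neg w i, (img_abs w i).+1)
                  (~~ img_neg w j, (img_abs w j).+1) <= tnth a j))
    (compatible w a).
Proof.
pose x0 := (0, (true, 0)).
have sz : size (map val a) = size (sperm_keys w).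
  by rewrite size_map size_tuple size_sperm_keys.
have nthE (i : 'I_n) : nth x0 (zip (map val a) (sperm_keys w)) i =
    (nat_of_ord (tnth a i), (~~ img_neg w i, (img_abs w i).+1)).
  rewrite nth_zip // nth_sperm_keys (nth_map ord0) ?size_tuple //.
  by rewrite (tnth_nth ord0).
have szz : size (zip (map val a) (sperm_keys w)) = n.
  by rewrite size_zip -sz minnn size_map size_tuple.
rewrite /compatible -[path _ _ _]/(sorted _ (_ :: _)).
rewrite sorted_pairwise; last exact/lift_lt_trans/key_lt_trans.
rewrite pairwise_cons; apply: (iffP andP) => -[h1 h2]; split.
- move=> i ni; have := all_nthP x0 h1 i; rewrite szz nthE => /(_ (ltn_ord i)).
  by rewrite /lift_lt /= ni.
- move=> i j ij; have := pairwiseP x0 h2 i j; rewrite !inE szz !nthE.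
  by apply=> //; apply: ltn_ord.
- apply/(all_nthP x0) => i; rewrite szz => lti.
  rewrite (nthE (Ordinal lti)) /lift_lt /=; have := h1 (Ordinal lti).
  by case: (img_neg _ _) => //= /(_ isT).
- apply/(pairwiseP x0) => i j; rewrite !inE szz => lti ltj ij.
  rewrite (nthE (Ordinal lti)) (nthE (Ordinal ltj)).
  exact: h2.
Qed.

Lemma signed_involutionsP n (w : {perm letter n}) :
  reflect ((forall x, w (letter_opp x) = letter_opp (w x)) /\ involutive w)
    (w \in signed_involutions n).
Proof.
rewrite !inE; apply: (iffP andP) => -[h1 h2]; split.
- by move=> x; apply/eqP; apply: (forallP h1).
- by move=> x; rewrite -{1}(eqP h2) permK.
- by apply/forallP => x; rewrite h1.
- by rewrite eq_invg_mul; apply/eqP/permP => x; rewrite permM perm1 h2.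
Qed.

Lemma img_involutive n (w : {perm letter n}) : w \in signed_involutions n ->
  forall i, img_abs w (img_abs w i) = i /\ img_neg w (img_abs w i) = img_neg w i.
Proof.
case/signed_involutionsP => wN wK i.
have := wK (false, i); have := wN (false, img_abs w i).
rewrite /img_abs /img_neg /letter_opp; case: (w (false, i)) => [[] j] /= h.
  by rewrite h; case: (w (false, j)) => [[] k] [].
by case: (w (false, j)) {h} => [[] k] [].
Qed.

Lemma signed_perm_eq n (w w' : {perm letter n}) :
  w \in signed_involutions n -> w' \in signed_involutions n ->
  img_neg w =1 img_neg w' -> img_abs w =1 img_abs w' -> w = w'.
Proof.
case/signed_involutionsP => wN _ /signed_involutionsP[wN' _] hn ha.
have e i : w (false, i) = w' (false, i).
  rewrite [LHS]surjective_pairing [RHS]surjective_pairing.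
  by rewrite -!/(img_neg _ _) -!/(img_abs _ _) hn ha.
apply/permP => -[[] i] //; by rewrite -[(true, i)]/(letter_opp (false, i)) wN wN' e.
Qed.

(** * Signed involutions and symmetric multisets of columns *)

Section SortedBlocks.
Variables (T : eqType) (le : rel T).
Hypotheses (le_tr : transitive le) (le_anti : antisymmetric le).

Lemma sorted_index_head x (t : seq T) : sorted le (x :: t) -> x \in t -> index x t = 0.
Proof.
case: t => [|y t] //=; case/andP=> xy; rewrite in_cons eq_sym path_sortedE //.
case: eqP => //= ne /andP[/allP yt _] xt.
by case: ne; apply: le_anti; rewrite xy yt.
Qed.

(** Antisymmetry makes the copies of [c] contiguous, so a position can be described by its entry and
    its rank within the block. *)
Lemma sorted_block c (t : seq T) r x0 : sorted le t -> r < count_mem c t ->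
  index c t + r < size t /\ nth x0 t (index c t + r) = c.
Proof.
elim: t r => [|x t IH] r //= st; have st' := path_sorted st.
have [e|ne] := eqVneq x c; last first.
  by rewrite add0n => /(IH _ st') [h1 h2]; rewrite addSn.
subst c.
case: r => [|r]; rewrite ?add0n // add1n ltnS => h.
have [h1 h2] := IH _ st' h; move: h1 h2; rewrite (sorted_index_head st) //.
by rewrite -has_pred1 has_count (leq_ltn_trans _ h).
Qed.

Lemma sorted_rank (t : seq T) i x0 : sorted le t -> i < size t ->
  i - index (nth x0 t i) t < count_mem (nth x0 t i) t.
Proof.
elim: t i => [|x t IH] [|i] //= st; first by rewrite eqxx.
have st' := path_sorted st; rewrite ltnS => it.
have := IH _ st' it; have [e|ne] := eqVneq x (nth x0 t i); last by rewrite add0n subSS.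
by rewrite -e (sorted_index_head st) ?subn0 ?add1n // e mem_nth.
Qed.

Lemma index_nth_le (t : seq T) i x0 : i < size t -> index (nth x0 t i) t <= i.
Proof.
by move=> it; rewrite leqNgt; apply/negP => /(before_find x0) /=; rewrite eqxx.
Qed.

End SortedBlocks.

Lemma index_tnth_le (T : eqType) n (t : n.-tuple T) (i : 'I_n) :
  index (tnth t i) t <= i.
Proof.
by rewrite (tnth_nth (tnth t i)); apply: index_nth_le; rewrite size_tuple.
Qed.

Lemma count_mem_tnth (T : eqType) n (t : n.-tuple T) (c : T) :
  count_mem c t = \sum_(i < n) (tnth t i == c).
Proof.
rewrite -sum1_count big_tuple big_mkcond /=; apply: eq_bigr => i _.
by case: (_ == _).
Qed.

Lemma sum_count_mem (T : finType) (t : seq T) : \sum_c count_mem c t = size t.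
Proof.
elim: t => [|x t IH] /=; first by rewrite big1.
rewrite big_split /= IH (bigD1 x) //= eqxx big1 ?addn0 // => c.
by rewrite eq_sym => /negPf ->.
Qed.

Lemma sum_ord_gt0 m : \sum_(b < m.+1) (0 < b) = m.
Proof. by rewrite big_ord_recl /= sum1_card card_ord. Qed.

(** * The bijection between compatible pairs and symmetric multisets of columns *)

Section Biwords.
Variables (m n : nat).

(* [(a, (p, b))] is the column with entries [a] and [b], and with [b] negative
   when [p] is false. *)
Notation column := ('I_m.+1 * (bool * 'I_m.+1))%type.

(** Lexicographic, with negative columns before positive ones among equal first entries, in
    agreement with [key_lt] on the values of [w]. *)
Definition column_le : rel column := fun c d =>
  (c.1 < d.1) || ((c.1 == d.1) &&
    ((~~ c.2.1 && d.2.1) || ((c.2.1 == d.2.1) && (c.2.2 <= d.2.2)))).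

Definition column_swap (c : column) : column := (c.2.2, (c.2.1, c.1)).

(* In a compatible word the value 0 is only taken before the first descent, where
   [w] is positive. *)
Definition columns : {set column} :=
  [set c : column | c.2.1 || ((0 < c.1) && (0 < c.2.2))].

Lemma column_swapK : involutive column_swap.
Proof. by case=> a [p b]. Qed.

Lemma column_swap_in c : (column_swap c \in columns) = (c \in columns).
Proof. by rewrite !inE [(0 < c.1) && _]andbC. Qed.

Lemma column_le_trans : transitive column_le.
Proof.
move=> [a [p b]] [a' [p' b']] [a'' [p'' b'']]; rewrite /column_le /= -!val_eqE /=.
by case: p p' p'' => [] [] [] /=; lia.
Qed.

Lemma column_le_anti : antisymmetric column_le.
Proof.
move=> [a [p b]] [a' [p' b']]; rewrite /column_le /= -!val_eqE /= => h.
have [e1 e2 e3] : [/\ a = a' :> nat, p = p' & b = b' :> nat].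
  by case: p p' h => [] [] /= h; split=> //; lia.
by rewrite e2; congr (_, (_, _)); apply: val_inj.
Qed.

Lemma column_le_total : total column_le.
Proof.
move=> [a [p b]] [a' [p' b']]; rewrite /column_le /= -!val_eqE /=.
by case: p p' => [] [] /=; lia.
Qed.

Lemma sum_columns (F : column -> nat) :
  \sum_c F c = \sum_(a < m.+1) (\sum_(b < m.+1) F (a, (true, b))
                              + \sum_(b < m.+1) F (a, (false, b))).
Proof.
transitivity (\sum_(a < m.+1) \sum_(q : bool * 'I_m.+1) F (a, q)).
  by rewrite pair_bigA; apply: eq_bigr => -[].
apply: eq_bigr => a _; transitivity (\sum_(p : bool) \sum_(b < m.+1) F (a, (p, b))).
  by rewrite pair_bigA; apply: eq_bigr => -[].
by rewrite big_bool.
Qed.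

Lemma card_columns : #|columns| = m.+1 ^ 2 + m ^ 2.
Proof.
rewrite -sum1_card big_mkcond sum_columns /= big_split /=; congr (_ + _).
  under eq_bigr => a _ do under eq_bigr => b _ do rewrite inE /=.
  under eq_bigr => a _ do rewrite sum1_card card_ord.
  by rewrite sum_nat_const card_ord mulnn.
transitivity (\sum_(a < m.+1) (0 < a) * \sum_(b < m.+1) (0 < b)); last first.
  by rewrite -big_distrl /= sum_ord_gt0 mulnn.
apply: eq_bigr => a _; rewrite big_distrr /=.
by apply: eq_bigr => b _; rewrite inE /=; case: (0 < a); case: (0 < b).
Qed.

Lemma card_fixed_columns :
  #|[set c in columns | column_swap c == c]| = (2 * m).+1.
Proof.
rewrite -sum1_card big_mkcond sum_columns /= big_split /=.
have -> : (2 * m).+1 = m.+1 + m by lia.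
(* Extracts the diagonal term: a column is fixed by the swap exactly when its two entries agree. *)
have del (a : 'I_m.+1) (F : 'I_m.+1 -> nat) : \sum_b (b == a) * F b = F a.
  by rewrite (bigD1 a) //= eqxx mul1n big1 ?addn0 // => b /negPf ->.
congr (_ + _).
  rewrite -[RHS]card_ord -sum1_card; apply: eq_bigr => a _.
  rewrite -[RHS](del a (fun=> 1)); apply: eq_bigr => b _.
  rewrite !inE /column_swap /= !xpair_eqE eqxx /= [a == b]eq_sym andbb.
  by case: eqP.
rewrite -[RHS]sum_ord_gt0; apply: eq_bigr => a _.
rewrite -[RHS](del a (fun b => (0 < b) : nat)); apply: eq_bigr => b _.
rewrite !inE /column_swap /= !xpair_eqE eqxx /= [a == b]eq_sym andbb.
case: eqP => [->|_]; rewrite ?andbF //= andbT andbb mul1n.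
by case: (0 < a).
Qed.

Definition biword (w : {perm letter n}) (a : n.-tuple 'I_m.+1) : n.-tuple column :=
  [tuple (tnth a i, (~~ img_neg w i, tnth a (img_abs w i))) | i < n].

Definition compat_pairs : {set {perm letter n} * n.-tuple 'I_m.+1} :=
  [set q | (q.1 \in signed_involutions n) && compatible q.1 q.2].

Lemma biword_tnth w a i : tnth (biword w a) i =
  (tnth a i, (~~ img_neg w i, tnth a (img_abs w i))).
Proof. by rewrite tnth_mktuple. Qed.

Lemma biword_nth w a (i : 'I_n) c : nth c (biword w a) i =
  (tnth a i, (~~ img_neg w i, tnth a (img_abs w i))).
Proof. by rewrite -tnth_nth biword_tnth. Qed.

Lemma compatible_le (w : {perm letter n}) (a : n.-tuple 'I_m.+1) (i j : 'I_n) :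
  compatible w a -> i <= j -> tnth a i <= tnth a j.
Proof.
case/compatibleP => _ h; rewrite leq_eqVlt => /orP[/eqP/val_inj -> //|/h].
exact/leq_trans/leq_addr.
Qed.

(** If [a_i = a_j] with [i < j], compatibility puts the key of [w i] below that of [w j]. So the
    signs are in order, and for equal signs [|w i| < |w j|], whence [a_|w i| <= a_|w j|] because [a]
    is weakly increasing. *)
Lemma biword_sorted w a : compatible w a -> sorted column_le (biword w a).
Proof.
move=> cwa; have [_ h] := compatibleP _ _ cwa.
pose c0 : column := (ord0, (true, ord0)).
rewrite sorted_pairwise; last exact: column_le_trans.
apply/(pairwiseP c0) => i j; rewrite !inE size_tuple => lti ltj ij.
rewrite (biword_nth w a (Ordinal lti)) (biword_nth w a (Ordinal ltj)).
have := h (Ordinal lti) (Ordinal ltj) ij.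
have := compatible_le (i := img_abs w (Ordinal lti)) (j := img_abs w (Ordinal ltj)) cwa.
rewrite /column_le /key_lt /= -!val_eqE /=.
case: (img_neg _ _); case: (img_neg _ _) => /=; lia.
Qed.

Lemma biword_img w a i : w \in signed_involutions n ->
  tnth (biword w a) (img_abs w i) = column_swap (tnth (biword w a) i).
Proof. by move=> /img_involutive/(_ i) [h1 h2]; rewrite !biword_tnth h1 h2. Qed.

Lemma column_sorted_le (t : n.-tuple column) (i j : 'I_n) :
  sorted column_le t -> i <= j -> column_le (tnth t i) (tnth t j).
Proof.
move=> st ij; pose c0 : column := (ord0, (true, ord0)).
rewrite !(tnth_nth c0).
apply: (sorted_leq_nth column_le_trans _ c0 st) => //; rewrite ?inE ?size_tuple //.
by move=> c; have := column_le_total c c; rewrite orbb.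
Qed.

(* Inside a block of equal columns [img_abs w] is increasing, so the rank of a
   position in its block cannot drop; as [w] is an involution, it is preserved. *)
Lemma biword_rank_le w a (i : 'I_n) : w \in signed_involutions n -> compatible w a ->
  i - index (tnth (biword w a) i) (biword w a) <=
  img_abs w i - index (column_swap (tnth (biword w a) i)) (biword w a).
Proof.
move=> wI cwa; have [_ h] := compatibleP _ _ cwa.
have st := biword_sorted cwa.
case: i => i; elim: i => [|i IH] lti; first by rewrite sub0n.
pose j := Ordinal (ltnW lti); pose k := Ordinal lti.
rewrite -/k; set q := index (tnth _ _) _.
have [iq|qi] := leqP i.+1 q; first by move: iq; rewrite -subn_eq0 => /eqP ->.
(* Position [i] lies between the first position [q] of the block and [i + 1], so sortedness gives it
   the same column. *)
have e : tnth (biword w a) k = tnth (biword w a) j.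
  apply: column_le_anti; rewrite [X in _ && X]column_sorted_le //= andbT.
  have ltq : q < n by exact: (ltn_trans qi lti).
  have -> : tnth (biword w a) k = tnth (biword w a) (Ordinal ltq).
    by rewrite [RHS](tnth_nth (tnth (biword w a) k)) nth_index // mem_tnth.
  exact: column_sorted_le.
have lt_img : img_abs w j < img_abs w k.
  move: e (h j k (ltnSn i)); rewrite !biword_tnth => -[-> -> _].
  by rewrite -[X in _ <= X]addn0 leq_add2l leqn0 eqb0 negbK /key_lt eqxx andNb.
have := IH (ltnW lti); rewrite -/j -e -/q.
have : index (column_swap (tnth (biword w a) k)) (biword w a) <= img_abs w j.
  by rewrite e -biword_img // index_tnth_le.
by rewrite [nat_of_ord j]/= [nat_of_ord k]/=; lia.
Qed.

(** The inequality [biword_rank_le] at [i] and at [img_abs w i] bounds each rank by the other. Thus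
    the word of columns alone determines [img_abs w]. *)
Lemma biword_rank w a (i : 'I_n) : w \in signed_involutions n -> compatible w a ->
  img_abs w i = index (column_swap (tnth (biword w a) i)) (biword w a) +
     (i - index (tnth (biword w a) i) (biword w a)) :> nat.
Proof.
move=> wI cwa; have := biword_rank_le i wI cwa.
have := biword_rank_le (img_abs w i) wI cwa.
have [-> _] := img_involutive wI i; rewrite biword_img // column_swapK.
have : index (tnth (biword w a) i) (biword w a) <= i by apply: index_tnth_le.
have : index (column_swap (tnth (biword w a) i)) (biword w a) <= img_abs w i.
  by rewrite -biword_img // index_tnth_le.
by lia.
Qed.

(** The involution [img_abs w] carries the positions of [c] onto those of its swap. *)
Lemma biword_symm w a c : w \in signed_involutions n ->
  count_mem (column_swap c) (biword w a) = count_mem c (biword w a).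
Proof.
move=> wI; rewrite !count_mem_tnth.
rewrite [RHS](reindex_inj (can_inj (fun i => proj1 (img_involutive wI i)))).
apply: eq_bigr => i _; rewrite biword_img //.
by rewrite -(can_eq column_swapK (column_swap _)) column_swapK.
Qed.

Lemma biword_columns w a c : w \in signed_involutions n -> compatible w a ->
  c \in biword w a -> c \in columns.
Proof.
move=> wI /compatibleP[h _] /tnthP[i ->]; rewrite inE biword_tnth /=.
case ni: (img_neg w i) => //=; rewrite !h //.
by have [_ ->] := img_involutive wI i.
Qed.

Definition content N (q : {perm letter n} * n.-tuple 'I_m.+1) :
    {ffun column -> 'I_N.+1} :=
  [ffun c => inord (count_mem c (biword q.1 q.2))].

Lemma contentE N q c : n <= N -> content N q c = count_mem c (biword q.1 q.2) :> nat.
Proof.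
move=> nN; rewrite ffunE inordK // ltnS (leq_trans (count_size _ _)) //.
by rewrite size_tuple.
Qed.

Lemma content_in N q : n <= N -> q \in compat_pairs ->
  content N q \in symm_mset column_swap columns N n.
Proof.
move=> nN; rewrite inE => /andP[wI cwa]; apply/symm_msetP; split.
- under eq_bigr => c _ do rewrite contentE //.
  by rewrite sum_count_mem size_tuple.
- by move=> c; apply: val_inj => /=; rewrite !contentE // biword_symm.
- move=> c cL; rewrite contentE //; apply/count_memPn.
  by apply: contra cL; apply: biword_columns.
Qed.

(** The content determines the sorted word; its columns display [a] and the signs of [w], and
    [biword_rank] recovers the absolute values. *)
Lemma content_inj N : n <= N -> {in compat_pairs &, injective (content N)}.
Proof.
move=> nN [w a] [w' a']; rewrite inE => /andP[/= wI cwa].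
rewrite inE => /andP[/= wI' cwa'] e.
have eb : biword w a = biword w' a'.
  apply/val_inj/(sorted_eq column_le_trans column_le_anti); try exact: biword_sorted.
  apply/allP => c _ /=; have := contentE (w, a) c nN.
  by rewrite e contentE //= => ->.
have ea : a = a'.
  apply: eq_from_tnth => i; have := congr1 (fun t => (tnth t i).1) eb.
  by rewrite !biword_tnth.
have en i : img_neg w i = img_neg w' i.
  have := congr1 (fun t => (tnth t i).2.1) eb.
  by rewrite !biword_tnth => /negb_inj.
have ei i : img_abs w i = img_abs w' i.
  apply: val_inj => /=.
  by rewrite (biword_rank i wI cwa) (biword_rank i wI' cwa') eb.
by rewrite ea (signed_perm_eq wI wI' en ei).
Qed.

(** The involution is built by sending each copy of a column to the copy of its swap with the same
    rank; equal multiplicities ensure that this copy exists. *)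
Lemma biword_surj (t : n.-tuple column) : sorted column_le t ->
  (forall c, count_mem (column_swap c) t = count_mem c t) ->
  {subset t <= columns} ->
  exists w a, [/\ w \in signed_involutions n, compatible w a & biword w a = t].
Proof.
move=> st sy tL; pose c0 : column := (ord0, (true, ord0)).
have tr := column_le_trans; have anti := column_le_anti.
pose rank (i : 'I_n) := i - index (tnth t i) t.
have rank_lt i : rank i < count_mem (column_swap (tnth t i)) t.
  rewrite sy /rank (tnth_nth c0); apply: (sorted_rank tr anti) => //.
  by rewrite size_tuple.
have Vlt i : index (column_swap (tnth t i)) t + rank i < n.
  by have [] := sorted_block tr anti c0 st (rank_lt i); rewrite size_tuple.
pose V i := Ordinal (Vlt i).
have tV i : tnth t (V i) = column_swap (tnth t i).
  by rewrite (tnth_nth c0); have [] := sorted_block tr anti c0 st (rank_lt i).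
have VK : involutive V.
  move=> i; apply: val_inj => /=; rewrite tV column_swapK /rank tV /=.
  have : index (tnth t i) t <= i by apply: index_tnth_le.
  by rewrite /rank; lia.
(* The sign flips exactly at negative columns; a column and its swap share their sign, so [W] is
   again an involution. *)
pose W (x : letter n) : letter n := (x.1 (+) ~~ (tnth t x.2).2.1, V x.2).
have WK : involutive W.
  by case=> b i; rewrite /W /= tV VK /=; congr (_, _); case: b; case: (_.2.1).
pose w := perm (inv_inj WK).
pose a := [tuple (tnth t i).1 | i < n].
have wn i : img_neg w i = ~~ (tnth t i).2.1 by rewrite /img_neg permE.
have wa i : img_abs w i = V i by rewrite /img_abs permE.
have aE i : tnth a i = (tnth t i).1 by rewrite tnth_mktuple.
exists w, a; split.
- apply/signed_involutionsP; split=> x; rewrite !permE ?WK //.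
  by case: x => b i; rewrite /W /letter_opp /= addNb.
- apply/compatibleP; split=> [i|i j ij].
    rewrite wn aE; have := tL _ (mem_tnth i t); rewrite inE.
    by case: (_.2.1) => //= /andP[].
  have := column_sorted_le st (ltnW ij); rewrite !wn !wa !aE !negbK.
  (* The column at [V i] starts with the second entry of the column at [i], so sortedness orders the
     images. *)
  have Vmono : (tnth t i).2.2 < (tnth t j).2.2 -> V i < V j.
    move=> lt; rewrite ltnNge; apply/negP => /(column_sorted_le st).
    rewrite !tV /column_le /= -!val_eqE /=; lia.
  have Veq : tnth t i = tnth t j -> V i < V j.
    have : index (tnth t i) t <= i by apply: index_tnth_le.
    by move=> le e; rewrite /= /rank -e; lia.
  rewrite /column_le /key_lt ltnS.
  case: (tnth t i) (tnth t j) Vmono Veq => [x [p y]] [x' [p' y']].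
  move: (nat_of_ord (V i)) (nat_of_ord (V j)) => vi vj /= h1 h2.
  have {}h2 : x = x' :> nat -> p = p' -> y = y' :> nat -> vi < vj.
    by move=> /val_inj e1 e2 /val_inj e3; apply: h2; rewrite e1 e2 e3.
  rewrite -val_eqE /=; have [xx|xx|xx] := ltngtP (x : nat) x' => //=.
    by move=> _; case: (~~ _); lia.
  case: p p' h2 => [] [] //= h2; rewrite ?xx ?addn0 // -?[_ <= vj]/(vi < vj).
    by have [/h1 ->|//|/(h2 xx erefl) ->] := ltngtP (y : nat) y'; rewrite ?addn0.
  by have [/h1 ->|//|/(h2 xx erefl) ->] := ltngtP (y : nat) y'; rewrite ?addn0.
- apply: eq_from_tnth => i; rewrite biword_tnth wn wa !aE tV negbK.
  by case: (tnth t i) => ? [].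
Qed.

Lemma content_surj N A : n <= N -> A \in symm_mset column_swap columns N n ->
  exists2 q, q \in compat_pairs & content N q = A.
Proof.
move=> nN /symm_msetP[sumA symA suppA].
pose t := sort column_le (flatten [seq nseq (A c) c | c <- enum {: column}]).
have countt c : count_mem c t = A c.
  rewrite count_sort count_flatten -map_comp sumnE big_map big_enum /=.
  rewrite (bigD1 c) //= count_nseq /= eqxx mul1n big1 ?addn0 // => d /negPf dc.
  by rewrite count_nseq /= dc.
have szt : size t = n.
  by rewrite -sum_count_mem -sumA; apply: eq_bigr => c _; rewrite countt.
have tt_n : size t == n by rewrite szt.
have [||c|w [a [wI cwa e]]] := @biword_surj (Tuple tt_n).
- exact/sort_sorted/column_le_total.
- by move=> c; rewrite /= !countt symA.
- rewrite /= => ct; apply: contraT => /suppA; rewrite -countt => /eqP.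
  by rewrite -leqn0 leqNgt -has_count has_pred1 ct.
exists (w, a); first by rewrite inE wI.
apply: symm_mset_val_inj => c; rewrite contentE // [biword _ _]e; exact: countt.
Qed.

Lemma card_compat_pairs N : n <= N ->
  #|compat_pairs| = #|symm_mset column_swap columns N n|.
Proof.
move=> nN; rewrite -(card_in_imset (content_inj nN)); apply: eq_card => A.
apply/imsetP/idP => [[q qE ->]|/(content_surj nN) [q qE <-]]; first exact: content_in.
by exists q.
Qed.

Lemma card_compat_pairs_sum :
  #|compat_pairs| = \sum_(w in signed_involutions n) 'C(m + n - desB w, n).
Proof.
under eq_bigr => w _ do rewrite -card_compatible -sum1_card.
rewrite pair_big_dep /= -sum1_card; apply: eq_bigl => q.
by rewrite inE [q.2 \in _]inE.
Qed.
End Biwords.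

Local Open Scope ring_scope.

(** * The recurrence for the coefficients *)

(** Extension by zero to negative indices, so that the shifts in the recurrence need no boundary
    cases. *)
Definition ext0 (c : nat -> int) (z : int) : int := if z is Posz k then c k else 0.

(* Satisfied by the coefficients [X], [P], [Q] of [IB_poly] for [n], [n - 1] and
   [n - 2]. *)
Definition eulerian_rec (n : int) (X P Q : int -> int) : Prop := forall z : int,
  n * X z = (2 * z + 1) * P z + (2 * n - 2 * z + 1) * P (z - 1)
    + (2 * z * (z + 1) + n - 1) * Q z
    + (4 * z * (n - z) - 2 * n + 2) * Q (z - 1)
    + (2 * (n - z) * (n - z + 1) + n - 1) * Q (z - 2).

Definition palindromic_unimodal (n : int) (X : int -> int) : Prop :=
  (forall z, X z = X (n - z)) /\ (forall z, 2 * z <= n -> X (z - 1) <= X z).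

(** The reflection of [z] to [n - z] permutes the terms of the recurrence, which gives the symmetry.
    The coefficients of [P] have a sum independent of [z], and so do those of [Q]; hence
    [n * (X z - X (z - 1))] is a combination of successive differences of [P] and [Q], with
    nonnegative coefficients for [0 < z] and [2 * z <= n]. *)
Lemma eulerian_rec_palindromic_unimodal (n : int) (X P Q : int -> int) :
  1 < n -> eulerian_rec n X P Q ->
  (forall z, 0 <= X z) -> (forall z, z < 0 -> X z = 0) ->
  palindromic_unimodal (n - 1) P -> palindromic_unimodal (n - 2) Q ->
  palindromic_unimodal n X.
Proof.
move=> n1 rX X0 Xn [Ps Pm] [Qs Qm]; split=> z.
  apply: (@mulfI _ n); first by lia.
  rewrite !rX (Ps z) (Ps (z - 1)) (Qs z) (Qs (z - 1)) (Qs (z - 2)).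
  have -> : n - 1 - z = n - z - 1 by ring.
  have -> : n - 1 - (z - 1) = n - z by ring.
  have -> : n - 2 - z = n - z - 2 by ring.
  have -> : n - 2 - (z - 1) = n - z - 1 by ring.
  have -> : n - 2 - (z - 2) = n - z by ring.
  by ring.
move=> zn; have [z0|z0] := leP z 0.
  by rewrite (Xn (z - 1)) ?X0 //; lia.
suff : 0 <= n * (X z - X (z - 1)) by rewrite pmulr_rge0 ?subr_ge0; lia.
rewrite mulrBr !rX.
have -> : z - 1 - 1 = z - 2 by ring.
have -> : z - 1 - 2 = z - 3 by ring.
have P2 : P (z - 2) <= P (z - 1) by have := Pm (z - 1); rewrite -addrA; apply; lia.
have Q2 : Q (z - 2) <= Q (z - 1) by have := Qm (z - 1); rewrite -addrA; apply; lia.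
have Q3 : Q (z - 3) <= Q (z - 2) by have := Qm (z - 2); rewrite -addrA; apply; lia.
have P1 : P (z - 1) <= P z.
  (* At [2 * z = n] the indices [z - 1] and [z] are mirror images for [P]. *)
  have [e|ne] := eqVneq (2 * z) n; last by apply: Pm; lia.
  by rewrite (Ps z); have -> : n - 1 - z = z - 1 by lia.
pose A : int := 2 * z * (z + 1) + n - 1.
pose B : int := 4 * z * (n - z + 1) - 2 * n + 2.
have A0 : 0 <= A by rewrite /A; nia.
have B0 : 0 <= B by rewrite /B; nia.
have Q1 : 0 <= A * (Q z - Q (z - 1)) + B * (Q (z - 1) - Q (z - 2)).
  (* Since [Q] is symmetric about [(n - 2) / 2], its difference at [z] vanishes for [2 * z = n - 1]
     and can be negative only for [2 * z = n]. *)
  have [e|ne] := eqVneq (2 * z) n; last first.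
    suff Q1 : Q (z - 1) <= Q z by rewrite addr_ge0 // mulr_ge0 // subr_ge0.
    have [e'|ne'] := eqVneq (2 * z) (n - 1); last by apply: Qm; lia.
    by rewrite (Qs z); have -> : n - 2 - z = z - 1 by lia.
  (* Now the two differences of [Q] are opposite, and [B - A = 2 * (z - 1) ^ 2 + 1] when
     [n = 2 * z]. *)
  rewrite (Qs z); have -> : n - 2 - z = z - 2 by lia.
  have -> : A * (Q (z - 2) - Q (z - 1)) + B * (Q (z - 1) - Q (z - 2)) =
         (B - A) * (Q (z - 1) - Q (z - 2)) by ring.
  by rewrite mulr_ge0 ?subr_ge0 // /A /B -e; nia.
pose D := 2 * (n - z + 1) * (n - z + 2) + n - 1.
have D0 : 0 <= D by rewrite /D; nia.
rewrite [X in 0 <= X](_ : _ = (2 * z + 1) * (P z - P (z - 1)) +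
    (2 * n - 2 * z + 3) * (P (z - 1) - P (z - 2)) +
   (A * (Q z - Q (z - 1)) + B * (Q (z - 1) - Q (z - 2))) +
   D * (Q (z - 2) - Q (z - 3))); last by rewrite /A /B /D; ring.
apply: addr_ge0; last by apply: mulr_ge0 => //; rewrite subr_ge0.
by apply: addr_ge0 Q1; apply: addr_ge0; apply: mulr_ge0; rewrite ?subr_ge0 //; lia.
Qed.

(** * Expansions in the binomial basis *)

(** The system is triangular: at [m = k] the terms beyond [k] vanish and [x k] has coefficient
    ['C(n, n) = 1]. *)
Lemma bin_basis_free (n : nat) (x : nat -> int) :
  (forall m, \sum_(k < n.+1) x k * 'C(m + n - k, n)%:Z = 0) ->
  forall k, (k <= n)%N -> x k = 0.
Proof.
move=> H; elim/ltn_ind => k IH kn.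
have := H k; rewrite (bigD1 (inord k)) //= inordK ?ltnS //.
rewrite addKn binn mulr1 big1 ?addr0 // => j jk.
have {}jk : (j : nat) != k.
  by apply: contra jk => /eqP <-; rewrite inord_val.
have [lt|ge] := ltnP j k; first by rewrite IH ?mul0r // -ltnS.
by rewrite bin_small ?mulr0 //; have := ltn_ord j; lia.
Qed.

(** With [m = j + r], every binomial is a rational multiple of ['C(r + n.+1, n.+1)]; multiplying by
    [n.+2] clears the denominators. For [m < j] all terms vanish. *)
Lemma bin_step1 (m n j : nat) : (j <= n.+1)%N ->
  (2 * m%:Z + 1) * 'C(m + n.+1 - j, n.+1)%:Z =
  (2 * j%:Z + 1) * 'C(m + n.+2 - j, n.+2)%:Z
  + (2 * n.+2%:Z - 2 * j.+1%:Z + 1) * 'C(m + n.+2 - j.+1, n.+2)%:Z.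
Proof.
move=> jn; have [mj|jm] := ltnP m j.
  by rewrite !bin_small ?mulr0 //; lia.
have [r ->] : exists r, m = (j + r)%N by exists (m - j)%N; lia.
have -> : (j + r + n.+1 - j = r + n.+1)%N by lia.
have -> : (j + r + n.+2 - j = (r + n.+1).+1)%N by lia.
have -> : (j + r + n.+2 - j.+1 = r + n.+1)%N by lia.
have := mul_bin_diag (r + n.+1).+1 n.+1; rewrite succnK.
have := mul_bin_left (r + n.+1) n.+1; rewrite addnK.
set b := 'C(r + n.+1, n.+1); set b1 := 'C(_, n.+2); set b2 := 'C(_.+1, n.+2).
move=> e1 e2.
apply: (@mulfI _ n.+2%:Z) => //.
have {}e1 : n.+2%:Z * b1%:Z = r%:Z * b%:Z by rewrite -!PoszM e1.
have {}e2 : n.+2%:Z * b2%:Z = (r%:Z + n%:Z + 2) * b%:Z by rewrite -PoszM -e2; lia.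
transitivity ((2 * j%:Z + 1) * (n.+2%:Z * b2%:Z)
  + (2 * n.+2%:Z - 2 * j.+1%:Z + 1) * (n.+2%:Z * b1%:Z)); last by ring.
rewrite e1 e2; have -> : n.+2%:Z = n%:Z + 2 by lia.
have -> : j.+1%:Z = j%:Z + 1 by lia.
by rewrite !PoszD; ring.
Qed.

(** As in [bin_step1], now with reference binomial ['C(r + n, n)] and common denominator
    [n.+1 * n.+2]. *)
Lemma bin_step2 (m n j : nat) : (j <= n)%N ->
  (2 * m%:Z * (m%:Z + 1) + n.+1%:Z) * 'C(m + n - j, n)%:Z =
  (2 * j%:Z * (j%:Z + 1) + n.+2%:Z - 1) * 'C(m + n.+2 - j, n.+2)%:Z
  + (4 * j.+1%:Z * (n.+2%:Z - j.+1%:Z) - 2 * n.+2%:Z + 2)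
    * 'C(m + n.+2 - j.+1, n.+2)%:Z
  + (2 * (n.+2%:Z - j.+2%:Z) * (n.+2%:Z - j.+2%:Z + 1) + n.+2%:Z - 1)
    * 'C(m + n.+2 - j.+2, n.+2)%:Z.
Proof.
move=> jn; have [mj|jm] := ltnP m j.
  by rewrite !bin_small ?mulr0 //; lia.
have [r ->] : exists r, m = (j + r)%N by exists (m - j)%N; lia.
have -> : (j + r + n - j = r + n)%N by lia.
have -> : (j + r + n.+2 - j = (r + n).+2)%N by lia.
have -> : (j + r + n.+2 - j.+1 = (r + n).+1)%N by lia.
have -> : (j + r + n.+2 - j.+2 = r + n)%N by lia.
have := mul_bin_diag (r + n).+2 n.+1; rewrite succnK.
have := mul_bin_diag (r + n).+1 n; rewrite succnK.
have := mul_bin_left (r + n).+1 n.+1; rewrite subSS addnK.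
have := mul_bin_left (r + n) n; rewrite addnK.
have := mul_bin_left (r + n) n.+1.
set b := 'C(r + n, n); set b1 := 'C(_, n.+1); set b2 := 'C(_, n.+2).
set d1 := 'C(_, n.+1); set d2 := 'C(_, n.+2); set d3 := 'C(_, n.+2).
move=> h1 h2 h3 h4 h5.
apply: (@mulfI _ (n.+1%:Z * n.+2%:Z)) => //.
have {}h2 : n.+1%:Z * b1%:Z = r%:Z * b%:Z by rewrite -!PoszM h2.
have {}h4 : n.+1%:Z * d1%:Z = (r%:Z + n%:Z + 1) * b%:Z by rewrite -PoszM -h4; lia.
have {}h1 : n.+1%:Z * n.+2%:Z * b2%:Z = r%:Z * (r%:Z - 1) * b%:Z.
  have -> : n.+1%:Z * n.+2%:Z * b2%:Z = (r%:Z - 1) * (n.+1%:Z * b1%:Z).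
    (* The natural subtraction truncates at [r = 0], where [b1] vanishes anyway. *)
    rewrite -mulrA -PoszM h1; case: (r) @b1 {h1 h2} => [|r'] b1.
      by rewrite /b1 bin_small // !muln0 !mulr0.
    by rewrite (_ : r'.+1 + n - n.+1 = r')%N; lia.
  by rewrite h2; ring.
have {}h3 : n.+1%:Z * n.+2%:Z * d2%:Z = r%:Z * (r%:Z + n%:Z + 1) * b%:Z.
  by rewrite -mulrA -PoszM h3 PoszM mulrCA h4; ring.
have {}h5 : n.+1%:Z * n.+2%:Z * d3%:Z = (r%:Z + n%:Z + 2) * (r%:Z + n%:Z + 1) * b%:Z.
  rewrite -mulrA -PoszM -h5 PoszM mulrCA h4.
  have -> : (r + n).+2%:Z = r%:Z + n%:Z + 2 by lia.
  by ring.
transitivity ((2 * j%:Z * (j%:Z + 1) + n.+2%:Z - 1) * (n.+1%:Z * n.+2%:Z * d3%:Z)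
  + (4 * j.+1%:Z * (n.+2%:Z - j.+1%:Z) - 2 * n.+2%:Z + 2)
    * (n.+1%:Z * n.+2%:Z * d2%:Z)
  + (2 * (n.+2%:Z - j.+2%:Z) * (n.+2%:Z - j.+2%:Z + 1) + n.+2%:Z - 1)
    * (n.+1%:Z * n.+2%:Z * b2%:Z)); last by ring.
rewrite h1 h3 h5.
have -> : n.+2%:Z = n%:Z + 2 by lia.
have -> : n.+1%:Z = n%:Z + 1 by lia.
have -> : j.+2%:Z = j%:Z + 2 by lia.
have -> : j.+1%:Z = j%:Z + 1 by lia.
rewrite !PoszD; ring.
Qed.

Lemma sum_shift (n : nat) (a : int -> int) (P : nat -> int) (B : nat -> int) :
  \sum_(k < n.+1) a k%:Z * ext0 P (k%:Z - 1) * B k =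
  \sum_(k < n) a k.+1%:Z * P k * B k.+1.
Proof.
rewrite big_ord_recl mulr0 mul0r add0r; apply: eq_bigr => i _.
by rewrite lift0 (_ : i.+1%:Z - 1 = i%:Z); last by lia.
Qed.

Lemma sum_shift2 (n : nat) (a : int -> int) (P : nat -> int) (B : nat -> int) :
  \sum_(k < n.+2) a k%:Z * ext0 P (k%:Z - 2) * B k =
  \sum_(k < n) a k.+2%:Z * P k * B k.+2.
Proof.
rewrite 2!big_ord_recl !mulr0 !mul0r !add0r; apply: eq_bigr => i _.
by rewrite !lift0 (_ : i.+2%:Z - 2 = i%:Z); last by lia.
Qed.

(** Expand the recurrence for [f] in the binomials of order [n + 2], using [bin_step1] and
    [bin_step2] for the polynomial factors in [m]. The defect [x] of the desired recurrence is then
    annihilated for every [m], so it is zero. *)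
Lemma hvector_rec (c : nat -> nat -> int) (f : nat -> nat -> int) (n : nat) :
  (forall i k, (i < k)%N -> c i k = 0) ->
  (forall i m, f i m = \sum_(k < i.+1) c i k * 'C(m + i - k, i)%:Z) ->
  (forall m, n.+2%:Z * f n.+2 m = (2 * m%:Z + 1) * f n.+1 m
                     + (2 * m%:Z * (m%:Z + 1) + n.+1%:Z) * f n m) ->
  eulerian_rec n.+2 (ext0 (c n.+2)) (ext0 (c n.+1)) (ext0 (c n)).
Proof.
move=> c0 fE rf.
pose x (k : nat) : int :=
  n.+2%:Z * ext0 (c n.+2) k -
   ((2 * k%:Z + 1) * ext0 (c n.+1) k
    + (2 * n.+2%:Z - 2 * k%:Z + 1) * ext0 (c n.+1) (k%:Z - 1)
    + (2 * k%:Z * (k%:Z + 1) + n.+2%:Z - 1) * ext0 (c n) k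
    + (4 * k%:Z * (n.+2%:Z - k%:Z) - 2 * n.+2%:Z + 2) * ext0 (c n) (k%:Z - 1)
    + (2 * (n.+2%:Z - k%:Z) * (n.+2%:Z - k%:Z + 1) + n.+2%:Z - 1)
      * ext0 (c n) (k%:Z - 2)).
have x0 k : (k <= n.+2)%N -> x k = 0.
  apply: bin_basis_free => {k} m.
  pose B k := 'C(m + n.+2 - k, n.+2)%:Z.
  have := rf m; rewrite !fE => /eqP; rewrite -subr_eq0 => /eqP E.
  rewrite -[RHS]E.
  rewrite [in RHS]big_distrr /=.
  under eq_bigr => k _ do rewrite /x mulrBl 4!mulrDl.
  rewrite sumrB 4!big_split.
  rewrite (sum_shift _ (fun z => 2 * n.+2%:Z - 2 * z + 1) _ B).
  rewrite (sum_shift _ (fun z => 4 * z * (n.+2%:Z - z) - 2 * n.+2%:Z + 2) _ B).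
  rewrite (sum_shift2 _
    (fun z => 2 * (n.+2%:Z - z) * (n.+2%:Z - z + 1) + n.+2%:Z - 1) _ B).
  congr (_ - _); first by apply: eq_bigr => k _; rewrite mulrA.
  (* The top terms of the unshifted and once-shifted sums vanish by [c0], which leaves all sums over
     a common range. *)
  rewrite big_ord_recr /= c0 // mulr0 mul0r addr0.
  rewrite -big_split /= -addrA -addrA; congr (_ + _).
    rewrite big_distrr /=; apply: eq_bigr => k _.
    rewrite mulrCA bin_step1 ?mulrDr; last by rewrite -ltnS.
    by rewrite /B; congr (_ + _); rewrite -mulrA mulrCA.
  rewrite 2!big_ord_recr /= 2?c0 // !(mulr0, mul0r, addr0).
  rewrite [X in _ + (X + _) = _]big_ord_recr /= c0 // !(mulr0, mul0r, addr0).
  rewrite -!big_split big_distrr /=; apply: eq_bigr => k _.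
  rewrite mulrCA bin_step2; last by rewrite -ltnS.
  by rewrite [RHS]mulrDr [X in _ = X + _]mulrDr -[RHS]addrA; congr (_ + (_ + _));
    rewrite -[LHS]mulrA [LHS]mulrCA.
case=> k; last first.
  by rewrite /= !mulr0.
have [kn|nk] := leqP k n.+2; first by apply/eqP; rewrite -subr_eq0; apply/eqP/x0.
(* Beyond [n + 2] even the shifted indices exceed the degrees, so every term is zero. *)
have -> : k%:Z - 1 = k.-1%:Z by lia.
have -> : k%:Z - 2 = k.-2%:Z by lia.
by rewrite /= !c0 ?mulr0 //; lia.
Qed.

(** * Coefficients of the descent polynomial *)

Lemma desB_le n (w : {perm letter n}) : (desB w <= n)%N.
Proof. by rewrite -[X in (_ <= X)%N]card_ord max_card. Qed.

Lemma coef_IB_poly n k :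
  (IB_poly n)`_k = \sum_(w in signed_involutions n) (desB w == k)%:R.
Proof.
by rewrite coef_sum; apply: eq_bigr => w _; rewrite coefXn eq_sym.
Qed.

Lemma coef_IB_poly_ge0 n k : 0 <= (IB_poly n)`_k.
Proof. by rewrite coef_IB_poly sumr_ge0. Qed.

Lemma coef_IB_poly_gt n k : (n < k)%N -> (IB_poly n)`_k = 0.
Proof.
move=> nk; rewrite coef_IB_poly big1 // => w _.
by rewrite (ltn_eqF (leq_ltn_trans (desB_le w) nk)).
Qed.

Lemma compat_pairs_IB_poly n m :
  #|compat_pairs m n|%:Z =
  \sum_(k < n.+1) (IB_poly n)`_k * 'C(m + n - k, n)%:Z.
Proof.
rewrite card_compat_pairs_sum.
under [RHS]eq_bigr => k _ do rewrite coef_IB_poly big_distrl /=.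
rewrite exchange_big /= -natz natr_sum; apply: eq_bigr => w _.
rewrite (bigD1 (inord (desB w))) //= inordK ?ltnS ?desB_le // eqxx mul1r.
rewrite big1 ?addr0 ?natz // => k kw.
suff /negPf -> : desB w != k by rewrite mul0r.
by apply: contra kw => /eqP ->; rewrite inord_val.
Qed.

Lemma compat_pairs_rec n m :
  n.+2%:Z * #|compat_pairs m n.+2|%:Z =
  (2 * m%:Z + 1) * #|compat_pairs m n.+1|%:Z
  + (2 * m%:Z * (m%:Z + 1) + n.+1%:Z) * #|compat_pairs m n|%:Z.
Proof.
(* The single multiplicity bound [n + 2] serves all three multiset sizes. *)
have := card_symm_mset_rec (@column_swapK m) (@column_swap_in m) (leqnn n.+2).
rewrite card_columns card_fixed_columns.
rewrite -!card_compat_pairs //; last exact: leqW.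
by move=> h; rewrite -PoszM h; lia.
Qed.

Lemma card_compat_pairs0 m : #|compat_pairs m 0| = 1%N.
Proof. by rewrite (card_compat_pairs m (leqnn 0)) card_symm_mset0. Qed.

Lemma card_compat_pairs1 m : #|compat_pairs m 1| = (2 * m).+1.
Proof.
rewrite (card_compat_pairs m (leqnn 1)) card_symm_mset1 ?card_fixed_columns //.
- exact: column_swapK.
- exact: column_swap_in.
Qed.

(** The recurrence has order two, so the induction carries two consecutive values of [n]. *)
Lemma IB_palindromic_unimodal (n : nat) :
  palindromic_unimodal n (ext0 (fun k => (IB_poly n)`_k)).
Proof.
pose c i k := (IB_poly i)`_k; rewrite -/(c n).
suff [] : palindromic_unimodal n (ext0 (c n)) /\
          palindromic_unimodal n.+1 (ext0 (c n.+1)) by [].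
have c0 i k : (i < k)%N -> c i k = 0 by apply: coef_IB_poly_gt.
elim: n => [|n [IH1 IH2]].
  have c00 : c 0%N 0%N = 1.
    have := compat_pairs_IB_poly 0 0; rewrite card_compat_pairs0.
    by rewrite big_ord1 bin0 mulr1.
  (* Evaluating the counts at [m = 0] and then [m = 1] isolates the two coefficients for [n = 1]. *)
  have c10 : c 1%N 0%N = 1.
    have := compat_pairs_IB_poly 1 0; rewrite card_compat_pairs1.
    by rewrite !big_ord_recr big_ord0 /= !bin1 -!/(c _ _); lia.
  have c11 : c 1%N 1%N = 1.
    have := compat_pairs_IB_poly 1 1; rewrite card_compat_pairs1.
    by rewrite !big_ord_recr big_ord0 /= !bin1 -!/(c _ _) c10; lia.
  have e0 z : ext0 (c 0%N) z = (z == 0)%:R.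
    by case: z => [[|k]|k] //=; rewrite ?c00 ?c0.
  have e1 z : ext0 (c 1%N) z = ((z == 0) || (z == 1))%:R.
    by case: z => [[|[|k]]|k] //=; rewrite ?c10 ?c11 ?c0.
  split; split=> z; rewrite ?e0 ?e1.
  - by congr (_%:R); congr nat_of_bool; lia.
  - by move=> h; rewrite ler_nat; lia.
  - by congr (_%:R); congr nat_of_bool; lia.
  - by move=> h; rewrite ler_nat; lia.
split=> //.
apply: (@eulerian_rec_palindromic_unimodal _ _ (ext0 (c n.+1)) (ext0 (c n))).
- by lia.
- by apply: (@hvector_rec c (fun i m => #|compat_pairs m i|%:Z)) => // [i m|m];
    [exact: compat_pairs_IB_poly | exact: compat_pairs_rec].
- by case=> // k; apply: coef_IB_poly_ge0.
- by case.
- by rewrite (_ : n.+2%:Z - 1 = n.+1) //; lia.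
- by rewrite (_ : n.+2%:Z - 2 = n) //; lia.
Qed.

Lemma unimodal_of_palindromic (c : nat -> int) (n : nat) :
  palindromic_unimodal n (ext0 c) -> unimodal c n.
Proof.
case=> sy mo; have {}mo k : (2 * k.+1 <= n)%N -> c k <= c k.+1.
  by move=> kn; have := mo k.+1; rewrite (_ : k.+1%:Z - 1 = k) ?PoszM; [apply; lia|lia].
have {}sy k : (k <= n)%N -> c k = c (n - k)%N.
  by move=> kn; have := sy k; rewrite (_ : n%:Z - k%:Z = (n - k)%N) //; lia.
exists n./2; split=> [|k kn|k nk kn].
- by lia.
- by apply: mo; lia.
rewrite (sy k) 1?ltnW // (sy k.+1) //.
(* For odd [n] the two middle coefficients mirror each other and are equal; all other pairs reflect
   into the increasing half. *)
have [e|ne] := eqVneq (2 * k).+1 n; last first.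
  have -> : (n - k = (n - k.+1).+1)%N by lia.
  by apply: mo; lia.
have -> : (n - k = k.+1)%N by lia.
by rewrite (sy k.+1).
Qed.

Theorem theorem4p2 (n : nat) (hn : (0 < n)%N) :
  unimodal (fun k : nat => (IB_poly n)`_k) n.
Proof. exact/unimodal_of_palindromic/IB_palindromic_unimodal. Qed.
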